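(* There exists a universal constant $c>0$ such that for arbitrarily large values of $n$ there is a simple graph with $n$ vertices having the following property: for the random walk on this graph started at some vertex $x$, there are another vertex $y$ and a time $t$ (a positive integer) for which $$\mathbf{P}_x(\tau(y)=t)\ge\frac{c\sqrt{\log n}}{t}.$$
   Context: The random walk $\{X_t\}_{t\ge0}$ on a graph moves at each step to a uniformly random neighbor of the current vertex. $\mathbf{P}_x$ denotes the probability for the walk started at $X_0=x$. The hitting time is $\tau(y)=\min\{t\ge 0: X_t=y\}$ ($\infty$ if $y$ is never reached). $\log$ is the natural logarithm. *)

(* Defs.v *)
From HB Require Import structures.
From mathcomp Require Import all_boot all_order all_algebra.
From mathcomp Require Import all_classical all_reals all_analysis.
From mathcomp Require Import measurable_realfun ring lra.
Import Order.TTheory GRing.Theory Num.Theory.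
Import numFieldNormedType.Exports.

Set Implicit Arguments.
Unset Strict Implicit.
Unset Printing Implicit Defensive.

Local Open Scope classical_set_scope.
Local Open Scope ring_scope.

Section Graph.
Variable V : finType.

Definition simple_graph (e : rel V) : Prop := symmetric e /\ irreflexive e.

Definition degree (e : rel V) (v : V) : nat := #|[set w | e v w]%SET|.

(* The random walk is defined at every vertex only if every vertex has a
   neighbor to move to. *)
Definition no_isolated_vertex (e : rel V) : Prop :=
  forall v, (0 < degree e v)%N.

Definition step_prob (R : realType) (e : rel V) (v w : V) : R :=
  if e v w then (degree e v)%:R^-1 else 0.

(* [None] stands for infinity: the trajectory never reaches y. *)
Definition hitting_time (X : nat -> V) (y : V) : option nat :=
  match pselect (exists t, X t == y) with
  | left h => Some (ex_minn h)
  | right _ => None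
  end.

End Graph.

Section RandomWalk.
Variables (R : realType) (V : finType).
Variables (d : measure_display) (Omega : measurableType d).

(* The trajectory agrees with w at all times 0, ..., t. *)
Definition follows (X : nat -> Omega -> V) (w : nat -> V) (t : nat) :
    set Omega :=
  [set o | forall i, (i <= t)%N -> X i o = w i].

(* The Markov property is written multiplicatively, so that it says nothing
   when the conditioning event X_0 = w_0, ..., X_t = w_t is negligible. *)
Record random_walk (P : probability Omega R) (e : rel V) (x : V)
    (X : nat -> Omega -> V) : Prop := RandomWalk {
  rw_measurable : forall t v, measurable [set o | X t o = v];
  rw_start : P [set o | X 0%N o = x] = 1%E;
  rw_step : forall (w : nat -> V) (t : nat),
    P (follows X w t.+1) =
      (P (follows X w t) * (step_prob R e (w t) (w t.+1))%:E)%E }.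

End RandomWalk.

Section Existence.
Variables (R : realType) (V : finType) (e : rel V) (x : V).
Hypothesis deg_gt0 : no_isolated_vertex e.

(* A walk driven by a single uniform variable u in [0, 1[: at each step u is
   multiplied by the degree, the integer part selects the neighbor and the
   fractional part is kept for the next step. The trajectories with a given
   beginning then form an interval whose length is their probability. *)
Let nb (v : V) : seq V := enum [set w | e v w]%SET.

Let size_nb v : size (nb v) = degree e v.
Proof. by rewrite /nb -cardE. Qed.

Let state : nat -> R -> V * R := fix state t u :=
  if t is s.+1 then
    let: (v, r) := state s u in
    let k := Num.truncn (r * (degree e v)%:R) in
    (nth v (nb v) k, r * (degree e v)%:R - k%:R)
  else (x, if 0 <= u < 1 then u else 0).

Let X t u := (state t u).1.

Let unit_set : set R := `[0, 1[.

Let cell (w : nat -> V) t W (a : R) :=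
  [/\ 0 <= a, a + W <= 1 & forall u, 0 <= u < 1 ->
    ((forall i, (i <= t)%N -> X i u = w i) <-> a <= u < a + W) /\
    (a <= u < a + W -> u = a + W * (state t u).2)].

Let rem01 t u : 0 <= (state t u).2 < 1.
Proof.
elim: t => [|t]; first by rewrite /=; case: ifP => // _; rewrite lexx ltr01.
rewrite /=; case: (state t u) => v r /= /andP[r0 r1].
have := @truncn_itv _ (r * (degree e v)%:R) (mulr_ge0 r0 (ler0n _ _)).
by rewrite -natr1; lra.
Qed.

Let weight (w : nat -> V) t : R :=
  (w 0%N == x)%:R * \prod_(i < t) step_prob R e (w i) (w i.+1).

Let cellP w t : (weight w t = 0 /\ forall u, 0 <= u < 1 ->
    ~ (forall i, (i <= t)%N -> X i u = w i)) \/
  (0 < weight w t /\ exists a, cell w t (weight w t) a).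
Proof.
elim: t => [|t IH].
  rewrite /weight big_ord0 mulr1; case: eqVneq => [w0|w0]; [right|left].
    split=> //; exists 0; split=> //; first by rewrite add0r.
    move=> u u01; rewrite add0r /= u01; split; last by rewrite add0r mul1r.
    by split=> // _ [|//] _; rewrite /X.
  by split=> // u _ /(_ 0%N isT) /= E; rewrite -E eqxx in w0.
have wS : weight w t.+1 = weight w t * step_prob R e (w t) (w t.+1).
  by rewrite /weight big_ord_recr /= mulrA.
have allS u : (forall i, (i <= t.+1)%N -> X i u = w i) <->
    (forall i, (i <= t)%N -> X i u = w i) /\ X t.+1 u = w t.+1.
  split=> [H|[H1 H2] i]; first by split=> [i it|]; apply: H => //; exact: leqW.
  by rewrite leq_eqVlt => /predU1P[->//|]; exact: H1.
case: IH => [[W0 H]|[W0 [a [a0 aW H]]]].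
  by left; rewrite wS W0 mul0r; split=> // u u01 /allS[] /(H _ u01).
set D : R := (degree e (w t))%:R.
have D0 : 0 < D by rewrite ltr0n deg_gt0.
have XS u : X t u = w t ->
    let k := Num.truncn ((state t u).2 * D) in
    [/\ (k < degree e (w t))%N, X t.+1 u = nth (w t) (nb (w t)) k,
      (state t.+1 u).2 = (state t u).2 * D - k%:R &
      k%:R <= (state t u).2 * D < k%:R + 1].
  have := rem01 t u; rewrite /X /=; case: (state t u) => v r /= /andP[r0 r1] ->.
  have /= := @truncn_itv _ (r * D) (mulr_ge0 r0 (ltW D0)).
  rewrite -/D -natr1 => kb; split=> //.
  by rewrite -(ltr_nat R); apply: (@le_lt_trans _ _ (r * D)); [lra|rewrite -/D; nra].
have [ew|ew] := boolP (e (w t) (w t.+1)); last first.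
  left; rewrite wS /step_prob (negbTE ew) mulr0; split=> // u u01 /allS[H1 H2].
  have [k1 k2 _ _] := XS u (H1 _ (leqnn t)).
  move: ew; rewrite -H2 k2.
  have /(mem_nth (w t)) : (Num.truncn ((state t u).2 * D) < size (nb (w t)))%N by rewrite size_nb.
  by rewrite mem_enum inE => ->.
right; rewrite wS /step_prob ew -/D.
set W := weight w t in W0 aW H *.
split; first by rewrite mulr_gt0 ?invr_gt0.
have wn : w t.+1 \in nb (w t) by rewrite mem_enum inE.
set k := index (w t.+1) (nb (w t)).
have kD : (k < degree e (w t))%N by rewrite -size_nb index_mem.
have kD' : k%:R + 1 <= D by rewrite natr1 ler_nat.
have k0 : 0 <= k%:R :> R by [].
set q := W / D.
have qD : W = q * D by rewrite /q divfK // gt_eqF.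
have q0 : 0 < q by rewrite /q divr_gt0.
exists (a + q * k%:R); split; [by nra|by nra|].
move=> u u01; have [H1 H2] := H u u01.
have key : (forall i, (i <= t)%N -> X i u = w i) ->
   (X t.+1 u = w t.+1 <-> Num.truncn ((state t u).2 * D) = k).
  move=> /(_ t (leqnn t)) /XS[b1 b2 _ _]; rewrite b2; split=> [E|->].
    by rewrite /k -E index_uniq ?size_nb // enum_uniq.
  by rewrite nth_index.
have r01 := rem01 t u.
split; last first.
  move=> ub; have ub' : a <= u < a + W by nra.
  have E := H2 ub'; have [b1 b2 b3 b4] := XS u (H1.2 ub' t (leqnn t)).
  rewrite b3; suff -> : Num.truncn ((state t u).2 * D) = k by rewrite {1}E qD; ring.
  apply: truncn_def; rewrite -natr1.
  by apply/andP; split; rewrite -(ler_pM2l q0) || rewrite -(ltr_pM2l q0); nra.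
split.
  move=> /allS[F1 F2]; have E := H2 (H1.1 F1).
  have [b1 b2 b3 b4] := XS u (F1 t (leqnn t)).
  by move: b4; rewrite ((key F1).1 F2) => b4; nra.
move=> ub; have ub' : a <= u < a + W by nra.
have F1 := H1.2 ub'; apply/allS; split=> //; apply/(key F1).
have E := H2 ub'.
apply: truncn_def; rewrite -natr1.
by apply/andP; split; rewrite -(ler_pM2l q0) || rewrite -(ltr_pM2l q0); nra.
Qed.

Let u0 (u : R) : R := if 0 <= u < 1 then u else 0.

Let mu0 : measurable_fun setT u0.
Proof.
rewrite /u0; apply: measurable_fun_if => //=.
  by apply: measurable_and => //; [exact: measurable_fun_ler|exact: measurable_fun_ltr].
Qed.

Let u01 u : 0 <= u0 u < 1.
Proof. by rewrite /u0; case: ifP => // _; rewrite lexx ltr01. Qed.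

Let XE t u : X t u = X t (u0 u).
Proof.
rewrite /X; suff -> : state t u = state t (u0 u) by [].
elim: t => [|t IH] /=; last by rewrite IH.
by rewrite {2}/u0 -/(u0 u) u01 /u0.
Qed.

Let followsP w t : (weight w t = 0 /\ follows X w t = set0) \/
  (0 < weight w t /\ exists a, [/\ 0 <= a, a + weight w t <= 1 &
     follows X w t = u0 @^-1` `[a, a + weight w t[%classic]).
Proof.
have fE u : follows X w t u <-> forall i, (i <= t)%N -> X i (u0 u) = w i.
  by split=> H i /H; rewrite -XE.
case: (cellP w t) => [[W0 H]|[W0 [a [a0 aW H]]]]; [left|right]; split=> //.
  by apply/seteqP; split=> // u /fE; exact: H.
exists a; split=> //; apply/seteqP; split=> u /=; rewrite in_itv /=.
  by move=> /fE h; apply: (H _ (u01 u)).1.1.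
by move=> h; apply/fE; apply: (H _ (u01 u)).1.2.
Qed.

Let mfollows w t : measurable (follows X w t).
Proof.
case: (followsP w t) => [[_ ->//]|[_ [a [_ _ ->]]]].
by rewrite -[X in measurable X]setTI; exact: mu0.
Qed.

Let mI : measurable (unit_set : set (measurableTypeR R)).
Proof. exact: measurable_itv. Qed.

Let leb : set (measurableTypeR R) -> \bar R := mrestr lebesgue_measure mI.

#[local] HB.instance Definition _ := Measure.on leb.

Let lebT : leb setT = 1%E.
Proof.
rewrite /leb /mrestr setTI /unit_set lebesgue_measure_itv /= lte_fin ltr01.
by rewrite sube0.
Qed.

#[local] HB.instance Definition _ := @Measure_isProbability.Build _ _ R leb lebT.

Let leb_follows w t : leb (follows X w t) = (weight w t)%:E.
Proof.
case: (followsP w t) => [[-> ->]|[W0 [a [a0 aW ->]]]]; first by rewrite measure0.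
rewrite /leb /mrestr.
have -> : u0 @^-1` `[a, a + weight w t[ `&` unit_set = `[a, a + weight w t[%classic.
  apply/seteqP; split=> u /=; rewrite /unit_set /= !in_itv /= /u0.
    by move=> [+ ub]; rewrite ub.
  move=> /andP[h1 h2]; have ub : 0 <= u < 1 by lra.
  by rewrite ub h1 h2.
rewrite lebesgue_measure_itv /= lte_fin ltrDl W0 -EFinB; congr (_%:E); ring.
Qed.

(* Consequently a statement about all random walks on such a graph is never
   vacuous. *)
Lemma random_walk_exists : exists (P : probability (measurableTypeR R) R)
  (X : nat -> measurableTypeR R -> V), random_walk P e x X.
Proof.
exists leb, X; split.
- move=> t v.
  have -> : [set o | X t o = v] = \bigcup_(w in [set w : {ffun 'I_t.+1 -> V} |
      w ord_max = v]) follows X (fun i => w (inord i)) t.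
    apply/seteqP; split=> [u <-|u [w /= <- /(_ t (leqnn t)) ->]].
      exists [ffun i : 'I_t.+1 => X i u]; first by rewrite /= ffunE.
      by move=> i it; rewrite ffunE inordK.
    by congr (w _); apply/val_inj; rewrite /= inordK.
  by apply: fin_bigcup_measurable => // w _; exact: mfollows.
- rewrite -lebT; congr (leb _); exact/seteqP.
- move=> w t; transitivity (weight w t.+1)%:E; first exact: leb_follows.
  rewrite [X in (X * _)%E](leb_follows w t) -EFinM; congr (_%:E).
  by rewrite /weight big_ord_recr /= mulrA.
Qed.
End Existence.

(* Main.v *)
(* Join all the leaves of a complete K-ary tree of depth L to one more vertex y
   and start the walk at the root x. Each of the K^L descents from x through a
   leaf to y has probability at least (K + 1)^-L / 2 and reaches y first at time
   L + 1, so P_x(tau(y) = L + 1) >= (K / (K + 1))^L / 2. For K = 2L this is at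
   least 1/4 by Bernoulli's inequality, whereas log n <= (L + 2) log K, so that
   sqrt(log n) / (L + 1) stays bounded. *)

Require Import Defs.
From mathcomp Require Import all_boot all_order all_algebra.
From mathcomp Require Import all_classical all_reals all_analysis.
From mathcomp Require Import zify lra.
Import Order.TTheory GRing.Theory Num.Theory.

Set Implicit Arguments.
Unset Strict Implicit.
Unset Printing Implicit Defensive.

Local Open Scope classical_set_scope.
Local Open Scope ring_scope.

(** * Hitting times and probabilities of finite paths *)

Lemma hitting_time_SomeP (V : finType) (X : nat -> V) (y : V) (t : nat) :
  hitting_time X y = Some t <-> X t = y /\ forall i, (i < t)%N -> X i <> y.
Proof.
rewrite /hitting_time; case: pselect => [h|h]; last first.
  by split=> // -[Xt _]; case: h; exists t; apply/eqP.
case: ex_minnP => m /eqP Xm m_min; split=> [[<-]|[Xt ltX]].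
  by split=> // i im /eqP /m_min; rewrite leqNgt im.
congr Some; apply/eqP; rewrite eqn_leq m_min ?Xt //= leqNgt.
by apply/negP => /ltX.
Qed.

Section HittingProbability.
Variables (R : realType) (V : finType) (e : rel V) (x : V).
Variables (d : measure_display) (Omega : measurableType d).
Variables (P : probability Omega R) (X : nat -> Omega -> V).
Hypothesis rwX : random_walk P e x X.

Lemma measurable_follows w t : measurable (follows X w t).
Proof.
have -> : follows X w t = \bigcap_(i in `I_t.+1) [set o | X i o = w i].
  by apply/seteqP; split=> o h i it; apply: h.
by apply: bigcap_measurableType => i _; exact: rw_measurable rwX i (w i).
Qed.

Lemma measurable_hitting_time y t :
  measurable [set o | hitting_time (fun i => X i o) y = Some t].
Proof.
have -> : [set o | hitting_time (fun i => X i o) y = Some t] =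
    [set o | X t o = y] `&` \bigcap_(i in `I_t) ~` [set o | X i o = y].
  by apply/seteqP; split=> o /hitting_time_SomeP.
apply: measurableI; first exact: rw_measurable rwX t y.
apply: bigcap_measurableType => i _; apply: measurableC.
exact: rw_measurable rwX i y.
Qed.

Lemma probability_follows w t : w 0%N = x ->
  P (follows X w t) = (\prod_(i < t) step_prob R e (w i) (w i.+1))%:E.
Proof.
move=> w0; elim: t => [|t IH].
  rewrite big_ord0 -(rw_start rwX) -w0; congr (P _); apply/seteqP.
  by split=> o /= h; [exact: h|move=> i; rewrite leqn0 => /eqP ->].
by rewrite (rw_step rwX) IH -EFinM big_ord_recr.
Qed.

(** Paths that differ by time [t] give disjoint [follows] events, each inside the hitting event, so
    their probabilities add up to a lower bound. *)
Lemma hitting_time_probability_ge (I : finType) (w : I -> nat -> V) y t (p : R) :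
  (forall s, w s 0%N = x) -> (forall s, w s t = y) ->
  (forall s i, (i < t)%N -> w s i <> y) ->
  (forall s s', (forall i, (i <= t)%N -> w s i = w s' i) -> s = s') ->
  (forall s, p <= \prod_(i < t) step_prob R e (w s i) (w s i.+1)) ->
  ((#|I|%:R * p)%:E <= P [set o | hitting_time (fun i => X i o) y = Some t])%E.
Proof.
move=> w0 wt w_neq w_inj ple.
pose F s := follows X (w s) t.
have mF s : measurable (F s) by exact: measurable_follows.
have : (P (\bigcup_(s in setT) F s) <=
    P [set o | hitting_time (fun i => X i o) y = Some t])%E.
  apply: le_measure; rewrite ?inE.
  - by apply: fin_bigcup_measurable => //; exact: finite_finset.
  - exact: measurable_hitting_time.
  - move=> o [s _ /= Fs]; apply/hitting_time_SomeP; split=> [|i it].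
      by rewrite Fs // wt.
    by rewrite Fs ?(ltnW it) //; exact: w_neq.
apply: le_trans.
have trivF : trivIset setT F.
  move=> s s' _ _ [u [Fs Fs']]; apply: w_inj => i it.
  by rewrite -(Fs _ it) -(Fs' _ it).
rewrite measure_fin_bigcup //; last exact: finite_finset.
have -> : [set: I] = [set` index_enum I].
  by apply/seteqP; split=> s //= _; exact: mem_index_enum.
rewrite -fsbig_seq ?index_enum_uniq //.
rewrite (eq_bigr _ (fun s _ => probability_follows t (w0 s))).
rewrite sumEFin lee_fin mulr_natl -sumr_const.
exact: ler_sum.
Qed.

End HittingProbability.

(** * Transport of a graph to the vertex set ['I_n] *)

Section Relabelling.
Variables (V : finType) (e : rel V).

Definition ord_rel : rel 'I_#|V| := fun i j => e (enum_val i) (enum_val j).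

Lemma degree_ord_rel i : degree ord_rel i = degree e (enum_val i).
Proof.
rewrite /degree -(on_card_preimset (onW_bij _ (enum_val_bij V))).
by apply: eq_card => j; rewrite !inE.
Qed.

Lemma step_prob_ord_rel (R : realType) u v :
  step_prob R ord_rel (enum_rank u) (enum_rank v) = step_prob R e u v.
Proof. by rewrite /step_prob degree_ord_rel /ord_rel !enum_rankK. Qed.

Lemma simple_graph_ord_rel : simple_graph e -> simple_graph ord_rel.
Proof. by move=> [es ei]; split=> [i j|i]; [exact: es|exact: ei]. Qed.

Lemma no_isolated_vertex_ord_rel :
  no_isolated_vertex e -> no_isolated_vertex ord_rel.
Proof. by move=> ne i; rewrite degree_ord_rel. Qed.

End Relabelling.

(** * The tree with its leaves joined to one vertex *)

Section CappedTree.
Variables (k L : nat).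
Hypothesis L_gt0 : (0 < L)%N.

Local Notation word := (L.-bseq 'I_k.+1).

(** Since [behead [::] = [::]], the size test is what keeps the root from being its own child. *)
Definition child (s s' : seq 'I_k.+1) : bool :=
  (size s' == (size s).+1) && (behead s' == s).

(* The complete k.+1-ary tree of depth L, nodes being words that grow at the
   front, with one more vertex [None] joined to all the leaves. *)
Definition capped_tree : rel (option word) := fun u v =>
  match u, v with
  | Some s, Some s' => child s s' || child s' s
  | Some s, None | None, Some s => size s == L
  | None, None => false
  end.

Lemma simple_capped_tree : simple_graph capped_tree.
Proof.
split; first by move=> [s|] [s'|] //=; rewrite orbC.
move=> [s|] //=; rewrite orbb /child; apply/negP => /andP[/eqP ? _]; lia.
Qed.

Lemma val_insub_bseq (s : seq 'I_k.+1) :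
  (size s <= L)%N -> insub_bseq L s = s :> seq _.
Proof. by move=> sL; rewrite /insub_bseq insubdK. Qed.

Lemma no_isolated_capped_tree : no_isolated_vertex capped_tree.
Proof.
move=> u; apply/card_gt0P; case: u => [s|].
  have sL := size_bseq s; case Es: (val s) (sL) => [|a p] pL.
    (* The root has no parent, so a child is exhibited; it exists because [0 < L]. *)
    exists (Some (insub_bseq L [:: ord0])).
    by rewrite inE /= /child !val_insub_bseq // Es.
  exists (Some (insub_bseq L p)).
  by rewrite inE /= /child Es !val_insub_bseq ?(ltnW pL) //= !eqxx orbT.
exists (Some (insub_bseq L (nseq L ord0))).
by rewrite inE /= val_insub_bseq size_nseq.
Qed.

Lemma child_behead (s s' : word) : child s' s -> s' = insub_bseq L (behead s).
Proof.
move=> /andP[_ /eqP E]; apply/val_inj; rewrite /= E val_insub_bseq //.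
exact: size_bseq.
Qed.

(** The bound counts [k.+1] children and one parent. At the root [behead] returns the root itself,
    so the covering set is one too large there, which an upper bound tolerates. *)
Lemma degree_node (s : word) : (size s < L)%N ->
  (degree capped_tree (Some s) <= k.+2)%N.
Proof.
move=> sL; set B := Some (insub_bseq L (behead s)) |:
  [set Some (insub_bseq L (a :: s)) | a : 'I_k.+1]%SET.
apply: (@leq_trans #|B|); last first.
  apply: leq_trans (leq_card_setU _ _) _; rewrite cards1 add1n ltnS.
  by apply: leq_trans (leq_imset_card _ _) _; rewrite card_ord.
apply: subset_leq_card; apply/fintype.subsetP => -[s'|]; rewrite !inE /=; last first.
  by rewrite ltn_eqF.
case/orP=> [c|/child_behead ->]; last by rewrite eqxx.
apply/orP; right; case/andP: c; case Es': (val s') => [|a p] //= _ /eqP ps.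
apply/imsetP; exists a => //; congr Some; apply/val_inj.
by rewrite /= Es' ps val_insub_bseq.
Qed.

(** A child would be a word longer than [L], so only the parent and [None] remain. *)
Lemma degree_leaf (s : word) : size s = L ->
  (degree capped_tree (Some s) <= 2)%N.
Proof.
move=> sL; set B := [set None; Some (insub_bseq L (behead s))]%SET.
apply: (@leq_trans #|B|); last by rewrite cards2; case: eqP.
apply: subset_leq_card; apply/fintype.subsetP => -[s'|]; rewrite !inE //=.
case/orP=> [/andP[/eqP E _]|/child_behead ->]; last by rewrite eqxx.
by have := size_bseq s'; rewrite E sL ltnn.
Qed.

(** Words grow at the front, so the ancestor of the leaf [s] at depth [i] is its suffix of length
    [i]. *)
Definition descent (s : L.-tuple 'I_k.+1) (i : nat) : option word :=
  if (i <= L)%N then Some (insub_bseq L (drop (L - i) s)) else None.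

Lemma val_descent (s : L.-tuple 'I_k.+1) i :
  insub_bseq L (drop (L - i) s) = drop (L - i) s :> seq _.
Proof. by rewrite val_insub_bseq // size_drop size_tuple leq_subr. Qed.

Lemma descent0 s : descent s 0 = Some (insub_bseq L [::]).
Proof. by rewrite /descent subn0 drop_oversize ?size_tuple. Qed.

Lemma descent_last s : descent s L.+1 = None.
Proof. by rewrite /descent ltnn. Qed.

Lemma descent_neq s i : (i < L.+1)%N -> descent s i <> None.
Proof. by rewrite /descent ltnS => ->. Qed.

Lemma descent_inj s s' : descent s L = descent s' L -> s = s'.
Proof.
rewrite /descent leqnn => -[] /(congr1 val) /=.
by rewrite !val_descent subnn !drop0 => /val_inj.
Qed.

Lemma prod_step_descent (R : realType) s :
  k.+2%:R^-1 ^+ L / 2 <=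
  \prod_(i < L.+1) step_prob R capped_tree (descent s i) (descent s i.+1).
Proof.
(* The last step leaves a leaf, of degree at most 2; the [L] earlier ones leave inner nodes. *)
rewrite big_ord_recr /=; apply: ler_pM; rewrite ?exprn_ge0 ?invr_ge0 ?ler0n //.
  rewrite -[X in _ ^+ X]card_ord -prodr_const; apply: ler_prod => i _.
  rewrite invr_ge0 ler0n /=.
  have iL := ltn_ord i.
  have sz j : (j <= L)%N -> size (insub_bseq L (drop (L - j) s)) = j.
    by move=> jL; rewrite val_descent size_drop size_tuple subKn.
  have es : capped_tree (descent s i) (descent s i.+1).
    rewrite /descent (ltnW iL) iL /= /child !sz ?(ltnW iL) // eqxx /=.
    rewrite !val_descent -drop1 drop_drop; apply/orP; left.
    by apply/eqP; congr drop; lia.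
  rewrite /step_prob es lef_pV2 ?posrE ?ltr0n ?(leq_ltn_trans _ isT) //.
    rewrite ler_nat /descent (ltnW iL); apply: degree_node.
    by rewrite sz // ltnW.
  exact: no_isolated_capped_tree.
have sz : size (insub_bseq L (drop (L - L) s)) = L.
  by rewrite val_descent subnn drop0 size_tuple.
have es : capped_tree (descent s L) (descent s L.+1).
  by rewrite /descent leqnn ltnn /= sz.
rewrite /step_prob es lef_pV2 ?posrE ?ltr0n //.
  by rewrite ler_nat /descent leqnn; apply: degree_leaf.
exact: no_isolated_capped_tree.
Qed.

Lemma card_capped_tree :
  #|{: option word}| = (\sum_(i < L.+1) k.+1 ^ i).+1.
Proof. by rewrite card_option card_bseq card_ord. Qed.

End CappedTree.

Lemma bernoulli_ineq (R : realDomainType) (x : R) n : 0 <= x <= 1 ->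
  1 - n%:R * x <= (1 - x) ^+ n.
Proof.
move=> /andP[x0 x1]; elim: n => [|n IH]; first by rewrite mul0r subr0 expr0.
rewrite exprS -natr1; have n0 : 0 <= n%:R :> R by [].
have : (1 - x) * (1 - n%:R * x) <= (1 - x) * (1 - x) ^+ n.
  by rewrite ler_wpM2l // subr_ge0.
(* Expanding the product on the left gives the wanted bound plus [n * x ^ 2]. *)
by have := mulr_ge0 n0 (mulr_ge0 x0 x0); nra.
Qed.

(** With [K = 2L], the crude bound [ln K <= K] suffices: it gives [2L (L + 2)], and a square on the
    right is what the later square root needs. *)
Lemma ln_sum_geometric_le (R : realType) (L : nat) : (0 < L)%N ->
  ln ((\sum_(i < L.+1) L.*2 ^ i).+1%:R) <= (2 * L.+1%:R) ^+ 2 :> R.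
Proof.
move=> L0; have K2 : (1 < L.*2)%N by lia.
have nle : ((\sum_(i < L.+1) L.*2 ^ i).+1 <= L.*2 ^ L.+2)%N.
  (* Each of the [L + 1 <= K] terms is at most [K ^ L]; the next power of [K] then absorbs the
     successor. *)
  have S : (\sum_(i < L.+1) L.*2 ^ i <= L.*2 ^ L.+1)%N.
    apply: (@leq_trans (\sum_(i < L.+1) L.*2 ^ L)).
      by apply: leq_sum => i _; rewrite leq_exp2l // -ltnS.
    by rewrite sum_nat_const card_ord expnS leq_mul2r; lia.
  by rewrite (leq_ltn_trans S) // ltn_exp2l.
have K0 : 0 < L.*2%:R :> R by rewrite ltr0n; lia.
apply: (@le_trans _ _ (ln ((L.*2 ^ L.+2)%:R))).
  by rewrite ler_ln ?posrE ?ltr0n ?expn_gt0 ?double_gt0 ?L0 // ler_nat.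
rewrite natrX lnXn // -[leLHS]mulr_natr.
have lnK : ln (L.*2%:R : R) <= L.*2%:R.
  have : ln (1 + (L.*2%:R - 1)) <= L.*2%:R - 1 :> R by apply: le_ln1Dx; lra.
  by rewrite addrC subrK; lra.
apply: (@le_trans _ _ (L.*2%:R * L.+2%:R)); first by rewrite ler_wpM2r.
by rewrite -!natrM -natrX ler_nat; nia.
Qed.

Theorem claim2p2 (R : realType) :
  exists c : R, 0 < c /\
    forall N : nat, exists n : nat, (N <= n)%N /\
      exists e : rel 'I_n, simple_graph e /\ no_isolated_vertex e /\
        exists (x y : 'I_n) (t : nat), x <> y /\ (0 < t)%N /\
          forall (d : measure_display) (Omega : measurableType d)
            (P : probability Omega R) (X : nat -> Omega -> 'I_n),
            random_walk P e x X ->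
            ((c * Num.sqrt (ln n%:R) / t%:R)%:E
              <= P [set o | hitting_time (fun i => X i o) y = Some t])%E.
Proof.
(* The probability is at least 1/4 and the square root at most [2 (L + 1)], hence 1/8. *)
exists (8^-1); split; first by lra.
(* The arity [k.+1] equals [2L], and [n > L > N]. *)
move=> N; pose L := N.+1; pose k := L.*2.-1.
have L0 : (0 < L)%N by [].
have kK : k.+1 = L.*2 by rewrite /k; lia.
pose V := option (L.-bseq 'I_k.+1).
have cV : #|{: V}| = (\sum_(i < L.+1) L.*2 ^ i).+1.
  by rewrite card_capped_tree kK.
exists #|{: V}|; split.
  rewrite cV big_ord_recr /=; have : (L < L.*2 ^ L)%N by apply: ltn_expl; lia.
  by rewrite /L; lia.
exists (ord_rel (@capped_tree k L)).
split; first exact/simple_graph_ord_rel/simple_capped_tree.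
split; first exact/no_isolated_vertex_ord_rel/no_isolated_capped_tree.
exists (enum_rank (Some (insub_bseq L [::]) : V)), (enum_rank (None : V)), L.+1.
split; first by move=> /enum_rank_inj.
split=> // d Omega P X rwX.
pose w s i : 'I_#|{: V}| := enum_rank (@descent k L s i).
have := @hitting_time_probability_ge _ _ _ _ _ _ _ _ rwX _ w
  (enum_rank (None : V)) L.+1 (k.+2%:R^-1 ^+ L / 2).
move=> H; apply: le_trans (H _ _ _ _ _); last first.
- move=> s; under eq_bigr do rewrite step_prob_ord_rel.
  exact: prod_step_descent.
- by move=> s s' /(_ L (leqnSn L)) /enum_rank_inj; exact: descent_inj.
- by move=> s i iL /enum_rank_inj; exact: descent_neq.
- by move=> s; rewrite /w descent_last.
- by move=> s; rewrite /w descent0.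
rewrite lee_fin card_tuple card_ord.
have t0 : 0 < L.+1%:R :> R by [].
(* Both sides are compared with 1/4: the left through the bound on [ln n], the right through
   Bernoulli's inequality. *)
apply: (@le_trans _ _ (4^-1)).
  rewrite ler_pdivrMr //.
  suff : Num.sqrt (ln #|{: V}|%:R) <= 2 * L.+1%:R :> R by lra.
  rewrite -(@ger0_norm _ (2 * L.+1%:R : R)) ?mulr_ge0 // -sqrtr_sqr.
  by rewrite ler_wsqrtr // cV ln_sum_geometric_le.
have k0 : 0 < k.+2%:R :> R by [].
(* The [k.+1 ^ L] descents combine with the bound for each into the [L]-th power of a single
   ratio. *)
rewrite natrX mulrA -exprMn.
have -> : k.+1%:R / k.+2%:R = 1 - k.+2%:R^-1 :> R.
  by rewrite -[k.+1%:R](addrK 1) natr1 mulrBl mulfV ?gt_eqF // mul1r.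
suff : 2^-1 <= (1 - k.+2%:R^-1) ^+ L :> R by lra.
apply: le_trans (bernoulli_ineq _ _); last first.
  by rewrite invr_ge0 ler0n invf_le1 // ler1n.
(* This holds because [k.+2 = 2L + 1]. *)
suff : L%:R / k.+2%:R <= 2^-1 :> R by move: (L%:R / _) => q; lra.
rewrite ler_pdivrMr // mulrC ler_pdivlMr // -natrM ler_nat.
by rewrite kK; lia.
Qed.
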